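(* Let $\mathbb{C}$ be an initial configuration of the block set $\mathbb{B}=\{1,\dots,B\}$ on $S$ stacks. Then $$f(\mathbb{B}) \;\ge\; f^{\mathrm{BG}}(\mathbb{B}) + f^{\overline{\mathrm{BG}}}(\mathbb{B}) \;\ge\; f^{\mathrm{BG}}(\mathbb{B}) + f^{\mathrm{BB}}(\mathbb{B})+f^{\mathrm{GB}}(\mathbb{B})+f^{\mathrm{GG}}(\mathbb{B}).$$
   Context: Setting (block relocation problem). There are $S$ stacks and $B$ blocks labelled by $\mathbb{B}=\{1,\dots,B\}$; a smaller label means a higher priority (earlier retrieval). A configuration places blocks in the stacks, each stack being a finite vertical sequence of blocks; the initial configuration $\mathbb{C}$ contains every block exactly once. A stack height limit $H$ may be imposed (each stack holds at most $H$ blocks; $H=\infty$ if there is no limit). Two kinds of moves exist. A relocation takes the topmost block of a stack and puts it on top of a different stack (respecting the height limit). A retrieval removes from the bay the block of smallest label among those still present, and is allowed only if that block is topmost in its stack. A feasible move sequence is a finite sequence of moves starting from $\mathbb{C}$ after which all blocks have been retrieved; it is assumed that at least one exists. It is also assumed that no block is directly retrievable in $\mathbb{C}$ (i.e. block $1$ is not topmost). In a given configuration, a block is badly placed (BP) if some block below it in the same stack has higher priority (smaller label); otherwise it is well placed (WP). A relocation is a BB, BG, GB or GG move, where the first letter is B (resp. G) if the moved block is BP (resp. WP) just before the move, and the second letter is B (resp. G) if it is BP (resp. WP) just after the move. A non-BG move is a BB, GB or GG move. For $\mathtt{B}\subseteq\mathbb{B}$: $f(\mathtt{B})$ is the minimum,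 over all feasible move sequences for $\mathbb{C}$, of the number of relocations implemented on blocks of $\mathtt{B}$. For $\mathrm{mt}\in\{\mathrm{BB},\mathrm{BG},\mathrm{GB},\mathrm{GG}\}$, $f^{\mathrm{mt}}(\mathtt{B})$ is the minimum, over all feasible move sequences, of the number of relocations of type mt implemented on blocks of $\mathtt{B}$. $f^{\overline{\mathrm{BG}}}(\mathtt{B})$ is the minimum, over all feasible move sequences, of the number of non-BG moves implemented on blocks of $\mathtt{B}$. (The minima are taken independently of one another.) *)

(* Defs.v *)
From HB Require Import structures.
From mathcomp Require Import all_boot.
From mathcomp Require Import boolp.

Set Implicit Arguments.
Unset Strict Implicit.
Unset Printing Implicit Defensive.

(* The block with label k in {1, ..., B} is the ordinal k - 1 of 'I_B, so that
   a smaller ordinal means a higher priority.  Stacks are listed from top to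
   bottom: the head of the sequence is the topmost block. *)
Definition config (S B : nat) := {ffun 'I_S -> seq 'I_B}.

Definition contains_each_block_once (S B : nat) (C : config S B) : bool :=
  perm_eq (flatten [seq C s | s <- enum 'I_S]) (enum 'I_B).

(* [None] stands for the absence of a height limit. *)
Definition fits (H : option nat) (n : nat) : bool :=
  if H is Some h then n <= h else true.

Definition respects_height (H : option nat) (S B : nat) (C : config S B) :
    bool :=
  [forall s, fits H (size (C s))].

Definition present (S B : nat) (C : config S B) (b : 'I_B) : bool :=
  [exists s, b \in C s].

Definition topmost (S B : nat) (C : config S B) (b : 'I_B) : bool :=
  [exists s, ohead (C s) == Some b].

Definition retrievable (S B : nat) (C : config S B) (b : 'I_B) : bool :=
  topmost C b && [forall b', present C b' ==> (b <= b')].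

Definition below (B : nat) (b : 'I_B) (st : seq 'I_B) : seq 'I_B :=
  drop (index b st).+1 st.

Definition badly_placed (S B : nat) (C : config S B) (b : 'I_B) : bool :=
  [exists s, (b \in C s) && has (fun b' : 'I_B => b' < b) (below b (C s))].

(* [Relocation s t] moves the topmost block of stack s onto stack t;
   [Retrieval s] removes the topmost block of stack s from the bay. *)
Inductive move (S : nat) : Type :=
  | Relocation of 'I_S & 'I_S
  | Retrieval of 'I_S.
Arguments Relocation {S}.
Arguments Retrieval {S}.

Definition step (H : option nat) (S B : nat) (C : config S B) (m : move S) :
    option (config S B) :=
  match m with
  | Relocation s t =>
      if C s is b :: st then
        if (s != t) && fits H (size (C t)).+1 then
          Some [ffun u => if u == s then st
                          else if u == t then b :: C t else C u]
        else None
      else None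
  | Retrieval s =>
      if C s is b :: st then
        if retrievable C b then Some [ffun u => if u == s then st else C u]
        else None
      else None
  end.

Fixpoint run (H : option nat) (S B : nat) (C : config S B) (w : seq (move S)) :
    option (config S B) :=
  if w is m :: w' then
    if step H C m is Some C' then run H C' w' else None
  else Some C.

Definition feasible (H : option nat) (S B : nat) (C : config S B)
    (w : seq (move S)) : bool :=
  if run H C w is Some C' then [forall b, ~~ present C' b] else false.

(* First component: the moved block is badly placed just before the move;
   second component: it is badly placed just after the move. *)
Definition move_type : Type := (bool * bool)%type.
Definition BB : move_type := (true, true).
Definition BG : move_type := (true, false).
Definition GB : move_type := (false, true).
Definition GG : move_type := (false, false).

(* The relocations performed along w, each given by its block and its type. *)
Fixpoint relocations (H : option nat) (S B : nat) (C : config S B)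
    (w : seq (move S)) : seq ('I_B * move_type) :=
  if w is m :: w' then
    if step H C m is Some C' then
      let rest := relocations H C' w' in
      if m is Relocation s _ then
        if C s is b :: _ then
          (b, (badly_placed C b, badly_placed C' b)) :: rest
        else rest
      else rest
    else [::]
  else [::].

(* The least element of A (0 if A is empty). *)
Definition min_nat (A : nat -> Prop) : nat :=
  if pselect (exists n, `[< A n >]) is left h then ex_minn h else 0.

Definition min_relocations (H : option nat) (S B : nat) (C : config S B)
    (P : pred ('I_B * move_type)) : nat :=
  min_nat (fun n => exists2 w, feasible H C w & n = count P (relocations H C w)).

Definition f (H : option nat) (S B : nat) (C : config S B) (A : {set 'I_B}) :
    nat :=
  min_relocations H C (fun r => r.1 \in A).

Definition f_mt (H : option nat) (S B : nat) (C : config S B) (mt : move_type)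
    (A : {set 'I_B}) : nat :=
  min_relocations H C (fun r => (r.1 \in A) && (r.2 == mt)).

Definition f_nonBG (H : option nat) (S B : nat) (C : config S B)
    (A : {set 'I_B}) : nat :=
  min_relocations H C (fun r => (r.1 \in A) && (r.2 \in [:: BB; GB; GG])).

(* Main.v *)
Require Import Defs.
From mathcomp Require Import all_boot.
From mathcomp Require Import boolp.

(** A move sequence that is optimal for one count is a candidate for every other
    count, so minima of counts are superadditive over disjoint classes of
    relocations.  BG and non-BG are disjoint classes of relocations; BB, GB and
    GG are disjoint classes of non-BG ones. *)

Lemma min_nat_mem (A : nat -> Prop) : (exists n, A n) -> A (min_nat A).
Proof.
move=> [n An]; rewrite /min_nat; case: pselect => [A_ex|[]].
  by case: ex_minnP => m /asboolP.
by exists n; apply/asboolP.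
Qed.

Lemma min_nat_leq (A : nat -> Prop) (n : nat) : A n -> min_nat A <= n.
Proof.
move=> An; rewrite /min_nat; case: pselect => // A_ex.
by case: ex_minnP => m _; apply; apply/asboolP.
Qed.

Lemma sum_count_leq {T : Type} {Ps : seq (pred T)} {Q : pred T} (s : seq T) :
  (forall x, count (fun P : pred T => P x) Ps <= Q x) ->
  \sum_(P <- Ps) count P s <= count Q s.
Proof.
move=> PsQ; elim: s => [|x s IHs] /=; first by rewrite big1.
by rewrite big_split leq_add //= -big_mkcond sum1_count.
Qed.

Section MinRelocations.

Variables (H : option nat) (S B : nat) (C : config S B).

Lemma min_relocations_leq (P : pred ('I_B * move_type)) (w : seq (move S)) :
  feasible H C w -> min_relocations H C P <= count P (relocations H C w).
Proof. by move=> w_feasible; apply: min_nat_leq; exists w. Qed.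

Hypothesis C_feasible : exists w : seq (move S), feasible H C w.

Lemma min_relocations_attained (P : pred ('I_B * move_type)) :
  exists2 w, feasible H C w &
    min_relocations H C P = count P (relocations H C w).
Proof.
apply: (min_nat_mem (fun n =>
  exists2 w, feasible H C w & n = count P (relocations H C w))).
by have [w w_feasible] := C_feasible; exists (count P (relocations H C w)), w.
Qed.

Lemma sum_min_relocations_leq (Ps : seq (pred ('I_B * move_type)))
    (Q : pred ('I_B * move_type)) :
  (forall r, count (fun P : pred ('I_B * move_type) => P r) Ps <= Q r) ->
  \sum_(P <- Ps) min_relocations H C P <= min_relocations H C Q.
Proof.
move=> PsQ; have [w w_feasible ->] := min_relocations_attained Q.
apply: leq_trans (sum_count_leq (relocations H C w) PsQ).
by apply: leq_sum => P _; apply: min_relocations_leq.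
Qed.

Lemma f_BG_nonBG_leq_f (A : {set 'I_B}) :
  f_mt H C BG A + f_nonBG H C A <= f H C A.
Proof.
have := sum_min_relocations_leq
  [:: fun r => (r.1 \in A) && (r.2 == BG);
      fun r => (r.1 \in A) && (r.2 \in [:: BB; GB; GG])] (fun r => r.1 \in A).
rewrite !big_cons big_nil addn0; apply.
by move=> [b [[] []]] /=; case: (b \in A).
Qed.

Lemma f_BB_GB_GG_leq_f_nonBG (A : {set 'I_B}) :
  f_mt H C BB A + f_mt H C GB A + f_mt H C GG A <= f_nonBG H C A.
Proof.
have := sum_min_relocations_leq
  [seq fun r => (r.1 \in A) && (r.2 == mt) | mt <- [:: BB; GB; GG]]
  (fun r => (r.1 \in A) && (r.2 \in [:: BB; GB; GG])).
rewrite big_map !big_cons big_nil addn0 addnA; apply.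
by move=> [b [[] []]] /=; case: (b \in A).
Qed.

End MinRelocations.

Theorem theorem1 (H : option nat) (S B : nat) (C : config S B)
    (C_blocks : contains_each_block_once C)
    (C_height : respects_height H C)
    (C_feasible : exists w : seq (move S), feasible H C w)
    (C_not_retrievable : forall b : 'I_B, ~~ retrievable C b) :
  f H C [set: 'I_B] >= f_mt H C BG [set: 'I_B] + f_nonBG H C [set: 'I_B] /\
  f_mt H C BG [set: 'I_B] + f_nonBG H C [set: 'I_B] >=
    f_mt H C BG [set: 'I_B] + f_mt H C BB [set: 'I_B] +
    f_mt H C GB [set: 'I_B] + f_mt H C GG [set: 'I_B].
Proof.
split; first exact: f_BG_nonBG_leq_f.
by rewrite -!addnA leq_add2l addnA; apply: f_BB_GB_GG_leq_f_nonBG.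
Qed.
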